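(* Let $G$ be a finite bipartite graph with at least one edge, and let $\tau$ be a positive integer. Then the bipartite walk defined on $G$ is periodic with period $\tau$ if and only if Grover's walk defined on $G$ is periodic with period $2\tau$.
   Context: All graphs are finite and simple. A walk with transition matrix $U$ is periodic if $U^k=I$ for some positive integer $k$; its period is the least such $k$. Bipartite walk: for a bipartite graph $G$ with color classes $C_0,C_1$, let $\pi_0$ (resp. $\pi_1$) be the partition of $E(G)$ in which two edges are in the same cell if and only if they have the same end in $C_0$ (resp. $C_1$). Let $P$ (resp. $Q$) be the orthogonal projection of $\mathbb{C}^{E(G)}$ onto the vectors that are constant on the cells of $\pi_0$ (resp. $\pi_1$). The transition matrix of the bipartite walk over $G$ is $(2P-I)(2Q-I)$. Grover's walk: the arc set of $G$ is $\mathcal{A}=\{(a,b),(b,a)\mid\{a,b\}\in E(G)\}$. For an arc $\alpha=(x,y)$ put $t(\alpha)=y$ and $\alpha^{-1}=(y,x)$. Let $D\in\mathbb{C}^{V(G)\times\mathcal{A}}$ have entries $D_{x,\alpha}=\frac{1}{\sqrt{\deg(x)}}$ if $x=t(\alpha)$ and $0$ otherwise, and let $R\in\mathbb{C}^{\mathcal{A}\times\mathcal{A}}$ be the arc-reversal matrix, $R_{\alpha,\beta}=1$ if $\alpha=\beta^{-1}$ and $0$ otherwise. The transition matrix of Grover's walk on $G$ is $R(2D^*D-I)$. *)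

(* Defs.v *)
From HB Require Import structures.
From mathcomp Require Import all_boot all_order all_algebra.
From mathcomp Require Import reals complex.

Set Implicit Arguments.
Unset Strict Implicit.
Unset Printing Implicit Defensive.

Import GRing.Theory Num.Theory.
Local Open Scope ring_scope.
Local Open Scope sesquilinear_scope.

Record sgraph := SGraph {
  vertex :> finType;
  adj : rel vertex;
  adj_sym : symmetric adj;
  adj_irr : irreflexive adj }.

Definition edges (G : sgraph) : {set {set G}} :=
  [set [set p.1; p.2] | p : G * G & adj p.1 p.2].

Definition arcs (G : sgraph) : {set G * G} := [set p | adj p.1 p.2].

Definition deg (G : sgraph) (x : G) : nat := #|[set y | adj x y]|.

Definition bipartition (G : sgraph) (C0 C1 : {set G}) : Prop :=
  [/\ C0 :|: C1 = [set: G], [disjoint C0 & C1],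
      {in C0 &, forall x y, ~~ adj x y} & {in C1 &, forall x y, ~~ adj x y}].

(* When C is a colour class, e :&: C is the singleton of the end of e in C,
   so two edges are in the same cell iff they have the same end in C. *)
Definition end_partition (G : sgraph) (C : {set G}) : {set {set {set G}}} :=
  preim_partition (fun e : {set G} => e :&: C) (edges G).

(* Coordinates of F^A are indexed by 'I_#|A|, coordinate i standing for the
   element enum_val i of A. *)
Section ConstantOnCells.
Variables (F : numClosedFieldType) (T : finType) (A : {set T}).
Variable pi : {set {set T}}.

Definition constant_on_cells (v : 'cV[F]_#|A|) : Prop :=
  forall B, B \in pi -> forall i j : 'I_#|A|,
    enum_val i \in B -> enum_val j \in B -> v i 0 = v j 0.

Definition cell_mx : 'M[F]_(#|pi|, #|A|) :=
  \matrix_(b, i) (enum_val i \in (enum_val b : {set T}))%:R.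

Lemma cell_mxP (v : 'cV[F]_#|A|) : partition pi A ->
  reflect (constant_on_cells v) (v^T <= cell_mx)%MS.
Proof.
move=> pA; have [/eqP cov tI _] := and3P pA.
have same (B : {set T}) (i : 'I_#|A|) (b : 'I_#|pi|) : B \in pi ->
    enum_val i \in B -> (enum_val i \in (enum_val b : {set T})) = (enum_val b == B).
  move=> Bpi iB; apply/idP/eqP => [ib|->//].
  by rewrite -(def_pblock tI Bpi iB) -(def_pblock tI (enum_valP b) ib).
apply: (iffP idP) => [/submxP[D vD] B Bpi i j iB jB|vc].
  have vE k : v k 0 = v^T 0 k by rewrite mxE.
  rewrite !vE vD !mxE; apply: eq_bigr => b _.
  by rewrite !mxE !(same B).
pose f (B : {set T}) : F :=
  if [pick i : 'I_#|A| | enum_val i \in B] is Some i then v i 0 else 0.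
have -> : v^T = (\row_b f (enum_val b)) *m cell_mx; last exact: submxMl.
apply/rowP => i; have iA := enum_valP i.
have Bpi : pblock pi (enum_val i) \in pi by apply: pblock_mem; rewrite cov.
have iB : enum_val i \in pblock pi (enum_val i) by rewrite mem_pblock cov.
rewrite !mxE (bigD1 (enum_rank_in Bpi (pblock pi (enum_val i)))) //=.
rewrite !mxE enum_rankK_in // iB mulr1 big1 ?addr0; last first.
  move=> b bn; rewrite !mxE (same _ _ _ Bpi iB).
  case: eqP => [bE|_]; last by rewrite mulr0.
  by case/eqP: bn; apply: enum_val_inj; rewrite enum_rankK_in.
rewrite /f; case: pickP => [j jB|/(_ i)]; last by rewrite iB.
exact: vc Bpi _ _ iB jB.
Qed.

(* [proj_ortho] acts on row vectors from the right; its transpose acts on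
   column vectors from the left.  The characteristic properties of the
   orthogonal projection are checked in [cell_projP]. *)
Definition cell_proj : 'M[F]_#|A| := (proj_ortho cell_mx)^T.

Lemma cell_projP (v : 'cV[F]_#|A|) : partition pi A ->
  constant_on_cells (cell_proj *m v) /\
  (forall w, constant_on_cells w -> w^t* *m (v - cell_proj *m v) = 0).
Proof.
move=> pA; split.
  by apply/cell_mxP; rewrite // trmx_mul trmxK proj_ortho_sub.
move=> w /(cell_mxP _ pA)/submxP[D wD].
have /[!orthomx1E]/eqP := proj_ortho_compl_sub cell_mx v^T.
set x := _ - _ => x_ort.
have -> : v - cell_proj *m v = x^T by rewrite linearB /= trmx_mul trmxK.
have -> : w^t* = map_mx Num.conj D *m map_mx Num.conj cell_mx.
  by rewrite -map_mxM -wD.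
apply: trmx_inj; rewrite !trmx_mul trmxK trmx0 mulmxA.
by rewrite map_trmx x_ort mul0mx.
Qed.

End ConstantOnCells.

Definition bipartite_walk (F : numClosedFieldType) (G : sgraph)
    (C0 C1 : {set G}) : 'M[F]_#|edges G| :=
  let P : 'M[F]_#|edges G| := cell_proj F (edges G) (end_partition C0) in
  let Q : 'M[F]_#|edges G| := cell_proj F (edges G) (end_partition C1) in
  (2 *: P - 1%:M) *m (2 *: Q - 1%:M).

Definition terminus_mx (F : numClosedFieldType) (G : sgraph) :
    'M[F]_(#|G|, #|arcs G|) :=
  \matrix_(x, a) if enum_val x == (enum_val a).2
                 then (sqrtC (deg (enum_val x))%:R)^-1 else 0.

Definition reversal_mx (F : numClosedFieldType) (G : sgraph) :
    'M[F]_#|arcs G| :=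
  \matrix_(a, b)
    (enum_val a == ((enum_val b).2, (enum_val b).1))%:R.

Definition grover_walk (F : numClosedFieldType) (G : sgraph) :
    'M[F]_#|arcs G| :=
  let D := terminus_mx F G in
  reversal_mx F G *m (2 *: (D^t* *m D) - 1%:M).

Definition periodic_with_period (F : numClosedFieldType) (n : nat)
    (U : 'M[F]_n) (k : nat) : Prop :=
  [/\ (0 < k)%N, U ^+ k = 1%:M &
      forall j, (0 < j)%N -> U ^+ j = 1%:M -> (k <= j)%N].

(* Main.v *)
(* An edge has two arcs, one ending in each colour class, so the arc space is the
   sum of two copies of the edge space, embedded by isometries J0 and J1.
   On the copy of arcs ending in C0 the operator D^* D acts as P, on the other
   one as Q, and R swaps the copies.  Hence the Grover walk W satisfies
   W J0 = J1 (2P - I) and W J1 = J0 (2Q - I): odd powers of W swap the copies and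
   are never the identity, while W^2 acts as U = (2P - I)(2Q - I) on the second
   copy and as a conjugate of U on the first. *)
Require Import Defs.
From mathcomp Require Import all_boot all_order all_algebra.
From mathcomp Require Import reals complex.

Set Implicit Arguments.
Unset Strict Implicit.
Unset Printing Implicit Defensive.

Import GRing.Theory Num.Theory.
Local Open Scope ring_scope.
Local Open Scope sesquilinear_scope.

(** * Explicit entries of the projections onto cell-constant vectors *)

Lemma conj_mul_self_eq0 (F : numClosedFieldType) n (d : 'cV[F]_n) :
  d^t* *m d = 0 -> d = 0.
Proof.
move=> /matrixP/(_ 0 0); rewrite !mxE => /eqP.
under eq_bigr do rewrite !mxE mulrC -normCK.
rewrite psumr_eq0 => [/allP d0|i _]; last by rewrite exprn_ge0.
apply/colP => i; rewrite mxE; apply/eqP.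
by have := d0 i (mem_index_enum i); rewrite expf_eq0 /= normr_eq0.
Qed.

Section CellProjection.
Variables (F : numClosedFieldType) (T : finType) (rT : eqType).
Variables (g : T -> rT) (A : {set T}).

Lemma constant_on_preim_cells (v : 'cV[F]_#|A|) :
  constant_on_cells (preim_partition g A) v <->
  (forall i j, g (enum_val i) = g (enum_val j) -> v i 0 = v j 0).
Proof.
have pA := preim_partitionP g A; have [/eqP cov tI _] := and3P pA.
have eqv : {in A & &, equivalence_rel (fun x y => g x == g y)}.
  by move=> x y z _ _ _; split=> // /eqP->.
split=> [vc i j gij|vc B Bpi i j iB jB].
  have iA := enum_valP i; have jA := enum_valP j.
  apply: (vc (pblock (preim_partition g A) (enum_val i))).
  - by apply: pblock_mem; rewrite cov.
  - by rewrite mem_pblock cov.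
  - by rewrite (pblock_equivalence_partition eqv) //= gij.
apply: vc; apply/eqP.
rewrite -(pblock_equivalence_partition eqv) ?enum_valP //.
by rewrite (def_pblock tI Bpi iB).
Qed.

(** The matrix on the right averages a vector over each cell. These entries are what can be compared
    with those of D^* D. *)
Lemma cell_proj_preimE :
  cell_proj F A (preim_partition g A) =
  \matrix_(i, j) ((g (enum_val i) == g (enum_val j))%:R /
                  #|[set z in A | g z == g (enum_val j)]|%:R).
Proof.
set P := cell_proj _ _ _; set M := \matrix_(i, j) _.
suff PM (v : 'cV_#|A|) : P *m v = M *m v.
  apply/matrixP => i j; have /colP/(_ i) := PM (delta_mx j 0).
  by rewrite -!colE !mxE.
have dM (d : 'cV_#|A|) :
    (forall i j, g (enum_val i) = g (enum_val j) -> d i 0 = d j 0) ->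
    d^t* *m M = d^t*.
  move=> dc; apply/rowP => j; rewrite mxE.
  pose c : F := #|[set z in A | g z == g (enum_val j)]|%:R.
  have c0 : c != 0.
    rewrite pnatr_eq0 -lt0n; apply/card_gt0P; exists (enum_val j).
    by rewrite inE enum_valP eqxx.
  (* Only indices in the cell of [j] contribute; there are [c] of them, each giving (d j)^* / c
     because [d] is constant on that cell. *)
  transitivity (\sum_(i < #|A|)
      (g (enum_val i) == g (enum_val j))%:R * ((d j 0)^* / c)).
    apply: eq_bigr => i _; rewrite !mxE -/c; case: eqP => [/dc ->|_].
      by rewrite !mul1r.
    by rewrite !mul0r mulr0.
  rewrite -mulr_suml -natr_sum.
  rewrite -(big_enum_val (fun x => (g x == g (enum_val j)) : nat)) /=.
  rewrite -big_mkcondr sum1_card /=.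
  rewrite (eq_card (B := [set z in A | g z == g (enum_val j)])); last first.
    by move=> z; rewrite !inE.
  by rewrite -/c mulrCA mulfV // mulr1 !mxE.
(* M v is also an orthogonal projection of v: d is constant on cells and
   orthogonal to all vectors constant on cells, itself included. *)
apply/eqP; rewrite -subr_eq0; apply/eqP/conj_mul_self_eq0.
have [Pc P_ort] := cell_projP v (preim_partitionP g A).
set d := P *m v - M *m v.
have dc i j : g (enum_val i) = g (enum_val j) -> d i 0 = d j 0.
  move=> gij; rewrite /d mxE [RHS]mxE; congr (_ + _).
    by move/constant_on_preim_cells: Pc; apply.
  by rewrite !mxE; congr (- _); apply: eq_bigr => k _; rewrite !mxE gij.
have {2}-> : d = (v - M *m v) - (v - P *m v) by rewrite opprB addrC addrA subrK.
rewrite mulmxBr P_ort; last exact/constant_on_preim_cells.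
by rewrite subr0 mulmxBr mulmxA dM // subrr.
Qed.
End CellProjection.

(** * The two copies of the edge space inside the arc space *)

(** A bipartition encoded by one colour class; facts about the other class then follow by passing to
    the complement. *)
Definition is_cut (G : sgraph) (C : {set G}) : Prop :=
  forall x y, adj x y -> (x \in C) = (y \notin C).

Lemma cut_of_bipartition (G : sgraph) (C0 C1 : {set G}) :
  bipartition C0 C1 -> is_cut C0 /\ C1 = ~: C0.
Proof.
case=> U01 D01 ind0 ind1.
have C1E : C1 = ~: C0.
  apply/setP => x; rewrite inE; move/setP/(_ x): U01; rewrite !inE.
  have [xC0 _|_ /=] := boolP (x \in C0); last by [].
  by rewrite (disjointFr D01 xC0).
split=> // x y xy; case xC: (x \in C0); case yC: (y \in C0) => //.
  by have := ind0 x y xC yC; rewrite xy.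
by have := ind1 x y; rewrite C1E !inE xC yC xy => /(_ isT isT).
Qed.

Definition arc_edge (T : finType) (a : T * T) : {set T} := [set a.1; a.2].

Section Cut.
Variables (F : numClosedFieldType) (G : sgraph) (C : {set G}).
Hypothesis cutC : is_cut C.

Lemma is_cut_setC : is_cut (~: C).
Proof. by move=> x y /cutC; rewrite !inE => ->. Qed.

Lemma arc_edge_setI a : a \in arcs G -> a.2 \in C -> arc_edge a :&: C = [set a.2].
Proof.
rewrite inE => /cutC a12 a2; apply/setP => x; rewrite !inE.
case: (x =P a.2) => [->|_]; first by rewrite a2 orbT.
by case: eqP => // ->; rewrite a12 a2.
Qed.

Lemma arc_edge_setD a : a \in arcs G -> a.2 \in C -> arc_edge a :\: C = [set a.1].
Proof.
rewrite inE => /cutC a12 a2; apply/setP => x; rewrite !inE.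
case: (x =P a.1) => [->|_]; first by rewrite a12 a2.
by case: eqP => [->|_] /=; rewrite ?a2 ?andbF.
Qed.

(** The end of the edge in [C] must be the head of the arc, and the other end its tail. *)
Lemma arc_edge_inj a b : a \in arcs G -> b \in arcs G ->
  a.2 \in C -> b.2 \in C -> arc_edge a = arc_edge b -> a = b.
Proof.
case: a b => [x y] [x' y'] aA bA aC bC ab.
have := arc_edge_setI aA aC; rewrite ab arc_edge_setI // => /set1_inj /= ->.
by have := arc_edge_setD aA aC; rewrite ab arc_edge_setD // => /set1_inj /= ->.
Qed.

Lemma edge_arcP e : e \in edges G ->
  exists a, [/\ a \in arcs G, a.2 \in C & arc_edge a = e].
Proof.
case/imsetP => -[x y]; rewrite inE /= => xy ->.
have [yC|yC] := boolP (y \in C); first by exists (x, y); rewrite inE.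
by exists (y, x); rewrite inE /= adj_sym (cutC xy) /arc_edge setUC.
Qed.

Lemma arc_edge_edges a : a \in arcs G -> arc_edge a \in edges G.
Proof. by rewrite inE => aA; apply/imsetP; exists a; rewrite ?inE. Qed.

(** The edges of the cell are those through the head of [a], one for each neighbour. Hence averaging
    over cells and the degree factors of D^* D use the same weights. *)
Lemma card_edge_cell a : a \in arcs G -> a.2 \in C ->
  #|[set e in edges G | e :&: C == arc_edge a :&: C]| = deg a.2.
Proof.
move=> aA aC; rewrite arc_edge_setI //.
have arcE y : adj a.2 y -> (y, a.2) \in arcs G by rewrite inE adj_sym.
rewrite /deg -(card_in_imset (f := fun y => arc_edge (y, a.2))
  (D := mem [set y | adj a.2 y])); last first.
  move=> y z; rewrite !inE => /arcE ay /arcE az yz.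
  by case: (arc_edge_inj ay az aC aC yz).
apply: eq_card => e; rewrite !inE; apply/andP/imsetP => [[eE]|[y]].
  have [b [bA bC <-]] := edge_arcP eE; rewrite arc_edge_setI // => /eqP/set1_inj.
  case: b bA bC => x y xyA yC /= yE; exists x; last by rewrite yE.
  by move: xyA; rewrite !inE yE adj_sym.
rewrite inE => /arcE ay ->; split; first exact: arc_edge_edges.
by rewrite arc_edge_setI.
Qed.

(** For a colour class [B] this is the embedding sending each edge to its orientation ending in
    [B]. *)
Definition inclusion_mx (B : {set G}) : 'M[F]_(#|arcs G|, #|edges G|) :=
  \matrix_(a, e)
    (((enum_val a).2 \in B) && (arc_edge (enum_val a) == enum_val e))%:R.
Local Notation J := inclusion_mx.

(** The single 1 in column [e] sits at the orientation of the edge that ends in [C], so right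
    multiplication by [J C] merely selects columns. *)
Lemma inclusion_mx_col e : exists k,
  [/\ (enum_val k).2 \in C, arc_edge (enum_val k) = enum_val e &
      forall a, J C a e = (a == k)%:R].
Proof.
have [b [bA bC be]] := edge_arcP (enum_valP e).
exists (enum_rank_in bA b); rewrite enum_rankK_in //; split=> // a.
rewrite mxE; congr (nat_of_bool _)%:R; apply/andP/eqP => [[aC /eqP ae]|->].
  apply: enum_val_inj; rewrite enum_rankK_in //.
  by apply: arc_edge_inj; rewrite ?enum_valP // be.
by rewrite enum_rankK_in // be.
Qed.

Lemma mulmx_inclusionE e k m (M : 'M_(m, _)) i :
  (forall a, J C a e = (a == k)%:R) -> (M *m J C) i e = M i k.
Proof.
move=> Je; rewrite mxE (bigD1 k) //= Je eqxx mulr1 big1 ?addr0 // => a ak.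
by rewrite Je (negPf ak) mulr0.
Qed.

Lemma inclusion_mx_row (a : 'I_#|arcs G|) : exists e0,
  enum_val e0 = arc_edge (enum_val a) /\
  forall B e, J B a e = ((enum_val a).2 \in B)%:R * (e == e0)%:R.
Proof.
have aE := arc_edge_edges (enum_valP a).
exists (enum_rank_in aE (arc_edge (enum_val a))).
rewrite enum_rankK_in //; split=> // B e; rewrite mxE -natrM mulnb eq_sym.
congr (nat_of_bool (_ && _))%:R; apply/eqP/eqP => [ea|->].
  by apply: enum_val_inj; rewrite enum_rankK_in.
by rewrite enum_rankK_in.
Qed.

Lemma inclusion_mxK : (J C)^T *m J C = 1%:M.
Proof.
apply/matrixP => e f; have [k [kC ke Jk]] := inclusion_mx_col f.
by rewrite (mulmx_inclusionE _ _ Jk) !mxE kC ke eq_sym (inj_eq enum_val_inj).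
Qed.

Lemma inclusion_mx_ortho : (J (~: C))^T *m J C = 0.
Proof.
apply/matrixP => e f; have [k [kC ke Jk]] := inclusion_mx_col f.
by rewrite (mulmx_inclusionE _ _ Jk) !mxE inE kC.
Qed.

(** Reversing an arc keeps its edge and moves its head to the other class. *)
Lemma reversal_inclusion : reversal_mx F G *m J C = J (~: C).
Proof.
apply/matrixP => a e; have [k [kC ke Jk]] := inclusion_mx_col e.
have kA := enum_valP k; have aA := enum_valP a.
rewrite (mulmx_inclusionE _ _ Jk) !mxE inE; congr (nat_of_bool _)%:R.
have a1C : ((enum_val a).1 \in C) = ((enum_val a).2 \notin C).
  by apply: cutC; move: aA; rewrite inE.
have revA : ((enum_val a).2, (enum_val a).1) \in arcs G.
  by move: aA; rewrite !inE adj_sym.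
have rev_edge : arc_edge ((enum_val a).2, (enum_val a).1) = arc_edge (enum_val a).
  by rewrite /arc_edge setUC.
rewrite -a1C -ke -rev_edge; apply/eqP/andP => [->|[aC /eqP ak]].
  by rewrite /= -surjective_pairing.
by rewrite -(arc_edge_inj revA kA aC kC ak) -surjective_pairing.
Qed.

Lemma terminus_gramE a b :
  ((terminus_mx F G)^t* *m terminus_mx F G) a b =
  ((enum_val a).2 == (enum_val b).2)%:R / (deg (enum_val a).2)%:R.
Proof.
rewrite mxE (bigD1 (enum_rank (enum_val a).2)) //= !mxE enum_rankK eqxx.
rewrite big1 ?addr0 => [|x xa]; last first.
  rewrite !mxE; case: eqP => [xE|_]; last by rewrite conjC0 mul0r.
  by rewrite -xE enum_valK eqxx in xa.
case: eqP => _; last by rewrite mulr0 mul0r.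
(* The entry of D is a nonnegative real, so conjugation fixes it and its square is the inverse
   degree. *)
by rewrite geC0_conj ?invr_ge0 ?sqrtC_ge0 ?ler0n // -expr2 exprVn sqrtCK mul1r.
Qed.

(** Two arcs ending in [C] have the same head exactly when their edges share a cell, whose size is
    the degree of that head. An arc ending outside [C] shares no head with them, and its row of
    [J C] is zero. *)
Lemma terminus_gram_inclusion :
  (terminus_mx F G)^t* *m terminus_mx F G *m J C =
  J C *m cell_proj F (edges G) (end_partition C).
Proof.
apply/matrixP => a e; have [k [kC ke Jk]] := inclusion_mx_col e.
have [e0 [e0E Ja]] := inclusion_mx_row a.
have kA := enum_valP k; have aA := enum_valP a.
rewrite (mulmx_inclusionE _ _ Jk) terminus_gramE mxE (bigD1 e0) //=.
rewrite big1 ?addr0 => [|f /negPf fe]; last by rewrite Ja fe mulr0 mul0r.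
rewrite Ja eqxx mulr1 cell_proj_preimE mxE e0E -ke card_edge_cell //.
have [aC|aC] := boolP ((enum_val a).2 \in C).
  rewrite mul1r !arc_edge_setI // (inj_eq set1_inj).
  by case: eqP => [->|_] //; rewrite !mul0r.
by rewrite mul0r; case: eqP => [E|_]; rewrite ?mul0r // E kC in aC *.
Qed.

Lemma grover_inclusion :
  grover_walk F G *m J C =
  J (~: C) *m (2 *: cell_proj F (edges G) (end_partition C) - 1%:M).
Proof.
rewrite /grover_walk -mulmxA mulmxBl -scalemxAl terminus_gram_inclusion.
rewrite mul1mx -reversal_inclusion -mulmxA; congr (_ *m _).
by rewrite mulmxBr mulmx1 scalemxAr.
Qed.

End Cut.

Lemma eqmx_on_inclusions (F : numClosedFieldType) (G : sgraph) (C : {set G}) m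
    (M N : 'M[F]_(m, #|arcs G|)) : is_cut C ->
  M *m inclusion_mx F C = N *m inclusion_mx F C ->
  M *m inclusion_mx F (~: C) = N *m inclusion_mx F (~: C) -> M = N.
Proof.
move=> cutC MN MN'; apply/matrixP => i a.
(* The hypotheses are symmetric in [C] and its complement, and every arc ends in one of the two;
   column [a] of [M] is then a column of [M *m J C]. *)
wlog aC : C cutC MN MN' / (enum_val a).2 \in C.
  move=> IH; have [|aC] := boolP ((enum_val a).2 \in C); first exact: IH.
  by apply: (IH (~: C)); rewrite ?setCK ?inE //; apply: is_cut_setC.
have [e [ae _]] := inclusion_mx_row F a.
have [k [kC ke Jk]] := inclusion_mx_col F cutC e.
have <- : k = a.
  by apply: enum_val_inj; apply: (arc_edge_inj cutC); rewrite ?enum_valP // ke.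
by rewrite -(mulmx_inclusionE M i Jk) MN (mulmx_inclusionE N i Jk).
Qed.

(** * Reflections and the comparison of periods *)

Lemma cell_reflection_sqr (F : numClosedFieldType) (T : finType) (A : {set T})
    (pi : {set {set T}}) :
  let X := 2 *: cell_proj F A pi - 1%:M in X *m X = 1%:M.
Proof.
move=> X; have PP : cell_proj F A pi *m cell_proj F A pi = cell_proj F A pi.
  by rewrite -trmx_mul proj_ortho_proj.
rewrite /X mulmxBl mul1mx mulmxBr mulmx1 -scalemxAl -scalemxAr PP opprB.
by rewrite [2 *: (2 *: _)]scaler_nat mulr2n addrK addrC subrK.
Qed.

(** The period argument in abstract form, with involutions [A] and [B] in place of 2P - I and 2Q -
    I. Positivity of [m] gives 1 != 0 on the small space, which excludes odd exponents. *)
Lemma period_double (F : numClosedFieldType) n m (W : 'M[F]_n) (A B : 'M[F]_m)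
    (J0 J1 : 'M[F]_(n, m)) (k : nat) :
    (0 < m)%N -> A *m A = 1%:M -> B *m B = 1%:M ->
    J1^T *m J1 = 1%:M -> J1^T *m J0 = 0 ->
    W *m J0 = J1 *m A -> W *m J1 = J0 *m B ->
    (forall M N : 'M[F]_n, M *m J0 = N *m J0 -> M *m J1 = N *m J1 -> M = N) ->
  periodic_with_period (A *m B) k <-> periodic_with_period W (2 * k).
Proof.
move=> m0 AA BB J11 J10 WJ0 WJ1 J_ext.
have WU j : W ^+ (2 * j) *m J1 = J1 *m (A *m B) ^+ j.
  elim: j => [|j IH]; first by rewrite muln0 !expr0 mul1mx mulmx1.
  rewrite mulnS exprD expr2 exprS -!mulmxE -mulmxA IH.
  by rewrite [LHS]mulmxA -[W *m W *m _]mulmxA WJ1 mulmxA WJ0 !mulmxA.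
(* Since [W] commutes with its powers, this form of [J0] shows that a power of [W] fixing [J1] also
   fixes [J0]. *)
have J0E : J0 = W *m J1 *m B by rewrite WJ1 -mulmxA BB mulmx1.
have W_even j : W ^+ (2 * j) = 1%:M <-> (A *m B) ^+ j = 1%:M.
  split=> [W1|U1].
    by rewrite -[LHS]mul1mx -J11 -mulmxA -WU W1 mul1mx.
  have WJ1_fix : W ^+ (2 * j) *m J1 = 1%:M *m J1 by rewrite WU U1 mulmx1 mul1mx.
  apply: J_ext => //.
  rewrite J0E !mulmxA mulmxE -exprSr exprS -mulmxE.
  by rewrite -(mulmxA W) WJ1_fix !mul1mx.
have W_odd j : W ^+ j = 1%:M -> ~~ odd j.
  move=> W1; apply/negP => oj.
  have jE : j = (2 * j./2).+1 by rewrite -[LHS]odd_double_half oj mul2n.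
  (* If an odd power were the identity, [J1] would factor through [J0]; multiplying by [J1^T] on the
     left would then give 1 = 0. *)
  have J1E : J1 = J0 *m (B *m (A *m B) ^+ j./2).
    rewrite -[LHS](mul1mx J1) -W1 [in LHS]jE exprS -mulmxE -mulmxA WU mulmxA WJ1.
    by rewrite mulmxA.
  move: J11; rewrite {2}J1E mulmxA J10 mul0mx.
  move=> /matrixP/(_ (Ordinal m0) (Ordinal m0)).
  by rewrite !mxE eqxx => /esym/eqP; rewrite oner_eq0.
split=> -[k0 k1 kmin]; split.
- by rewrite muln_gt0.
- exact/W_even.
(* Any exponent killing [W] is even, and its half kills [A *m B], so minimality of [k] applies to
   the half. *)
- move=> j j0 W1; have := W_odd j W1 => /even_halfK jE.
  move: j0 W1; rewrite -jE -mul2n muln_gt0 /= => j0 /W_even.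
  by rewrite leq_pmul2l //; apply: kmin.
- by move: k0; rewrite muln_gt0.
- exact/W_even.
- move=> j j0 /W_even W1; rewrite -(leq_pmul2l (isT : 0 < 2)%N).
  by apply: kmin; rewrite ?muln_gt0.
Qed.

Theorem corollary6p2 (R : realType) (G : sgraph) (C0 C1 : {set G}) (tau : nat)
    (hG : bipartition C0 C1) (hE : edges G != set0) (htau : (0 < tau)%N) :
  periodic_with_period (bipartite_walk R[i] C0 C1) tau <->
  periodic_with_period (grover_walk R[i] G) (2 * tau).
Proof.
have [cut0 C1E] := cut_of_bipartition hG.
have cut1 : is_cut C1 by rewrite C1E; apply: is_cut_setC.
have C0E : C0 = ~: C1 by rewrite C1E setCK.
(* Unification takes [A] and [B] to be the reflections for [C0] and [C1]; the existence of an edge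
   makes the edge space nonzero. *)
apply: (@period_double _ _ _ _ _ _ (inclusion_mx _ C0) (inclusion_mx _ C1)).
- by rewrite card_gt0.
- exact: cell_reflection_sqr.
- exact: cell_reflection_sqr.
- exact: inclusion_mxK.
- by rewrite C1E; apply: inclusion_mx_ortho.
- by rewrite C1E; apply: grover_inclusion.
- by rewrite [in RHS]C0E; apply: grover_inclusion.
- by rewrite C1E => M N; apply: eqmx_on_inclusions.
Qed.
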